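(* Let $n=2m>3$ be an even integer and let $a,b$ be natural numbers with $1\le a<b\le n-1$. For $i=1,\ldots,n$ let $s_i$ be the sum of the first $i$ entries of the $n$-tuple $(a,b,a,b,\ldots,a,b)$, i.e. $s_i=\frac{i+1}{2}a+\frac{i-1}{2}b$ for odd $i$ and $s_i=\frac{i}{2}(a+b)$ for even $i$. Then an equivalence class of $n$-polygons with $m$ axes is represented by the $n$-tuple $(a,b,a,b,\ldots,a,b)$ if and only if $s_i\not\equiv 0\pmod n$ for all $1\le i\le n-1$ and $s_n\equiv 0\pmod n$.
   Context: Fix $n\ge 3$ and the vertices $v_k=e^{2\pi i k/n}$, $k=0,\ldots,n-1$, on the unit circle. An $n$-polygon is a Hamiltonian cycle through these vertices: a closed path $v_{\sigma_1}\cdots v_{\sigma_n}v_{\sigma_1}$ of straight segments with $(\sigma_1,\ldots,\sigma_n)$ an ordering of $0,\ldots,n-1$. Its sides are the integers $e_i\in\{1,\ldots,n-1\}$ with $e_i\equiv\sigma_{i+1}-\sigma_i\pmod n$ ($\sigma_{n+1}=\sigma_1$); an $n$-tuple of sides represents a polygon if starting at a vertex and moving counterclockwise successively by the sides visits each vertex exactly once before returning to the start after the $n$-th step. Two $n$-polygons are equivalent if one is obtained from the other by a rotation about the center. An $n$-polygon with $m$ axes is one with exactly $m$ axes of reflection symmetry. *)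

(* Defs.v *)
(* The plane is R[i] over an arbitrary R : realType. *)
From mathcomp Require Export all_boot all_order all_fingroup all_algebra complex.
From mathcomp Require Export all_classical all_reals all_analysis.
From mathcomp Require Import zify.

Set Implicit Arguments.
Unset Strict Implicit.
Unset Printing Implicit Defensive.

Import Order.TTheory GRing.Theory Num.Theory.

Local Open Scope complex_scope.
Local Open Scope classical_set_scope.
Local Open Scope ring_scope.

Definition cis {R : realType} (t : R) : R[i] := cos t +i* sin t.

(* k is any natural number, so that the index is implicitly read modulo n. *)
Definition vertex (R : realType) (n k : nat) : R[i] :=
  cis (2%:R * pi * k%:R / n%:R).

Definition segment {R : realType} (p q : R[i]) : set R[i] :=
  [set p + t%:C * (q - p) | t in [set t : R | 0 <= t <= 1]].

(* A Hamiltonian cycle is identified with the set of its sides, each side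
   being a set of points of the plane. Neither an orientation nor a starting
   vertex is recorded. *)
Definition figure (R : realType) := set (set R[i]).

(* ordS is the cyclic successor on 'I_n, so the last side closes the path. *)
Definition is_polygon {R : realType} (n : nat) (P : figure R) : Prop :=
  exists s : {perm 'I_n},
    P = [set segment (vertex R n (s i)) (vertex R n (s (ordS i)))
        | i in [set: 'I_n]].

Definition move {R : realType} (f : R[i] -> R[i]) (P : figure R) : figure R :=
  [set f @` S | S in P].

Definition rotation {R : realType} (t : R) (z : R[i]) : R[i] := cis t * z.

Definition rot_equiv {R : realType} (P Q : figure R) : Prop :=
  exists t : R, Q = move (rotation t) P.

Definition polygon_class {R : realType} (n : nat) (C : set (figure R)) : Prop :=
  exists P : figure R,
    is_polygon n P /\ C = [set Q | is_polygon n Q /\ rot_equiv P Q].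

Definition line {R : realType} (p u : R[i]) : set R[i] :=
  [set p + t%:C * u | t in [set: R]].

(* Since u / u^* = (u / |u|) ^ 2, w |-> u / u^* * w^* is the reflection across
   the line through 0 directed by u; here it is transported to line p u. *)
Definition reflection {R : realType} (p u z : R[i]) : R[i] :=
  p + (u / u^*) * (z - p)^*.

(* The line is not assumed to pass through the center. *)
Definition is_axis {R : realType} (P : figure R) (L : set R[i]) : Prop :=
  exists p u : R[i], [/\ u != 0, L = line p u & move (reflection p u) P = P].

Definition has_axes {R : realType} (m : nat) (P : figure R) : Prop :=
  ([set L | is_axis P L] #= `I_m)%card.

Definition partial_sum (n : nat) (e : n.-tuple nat) (i : nat) : nat :=
  sumn (take i e).

(* Adding e_i to the index moves counterclockwise by e_i steps. *)
Definition position (n : nat) (e : n.-tuple nat) (k i : nat) : nat :=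
  (k + partial_sum e i)%N.

Definition represents {R : realType} (n : nat) (e : n.-tuple nat)
    (P : figure R) : Prop :=
  (forall x, x \in val e -> 1 <= x <= n - 1)%N /\
  exists k : 'I_n,
    [/\ forall j : 'I_n, exists! i : 'I_n, position e k i = j %[mod n],
        position e k n = k %[mod n]
      & P = [set segment (vertex R n (position e k i))
                         (vertex R n (position e k i.+1))
            | i in [set: 'I_n]]].

Definition class_represented {R : realType} (n : nat) (C : set (figure R))
    (e : n.-tuple nat) : Prop :=
  forall P, C P -> represents e P.

(* Indices start at 0 here, so the even ones carry a. *)
Definition alternating (n a b : nat) : n.-tuple nat :=
  [tuple (if odd i then b else a) | i < n].

Lemma partial_sum_alternating (n a b i : nat) : (i <= n)%N ->
  partial_sum (alternating n a b) i = (uphalf i * a + i./2 * b)%N.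
Proof.
rewrite /partial_sum; elim: i => [|i IHi] lin; first by rewrite take0.
rewrite (take_nth 0%N) ?size_tuple // sumn_rcons IHi ?(ltnW lin) //.
rewrite -[nth _ _ i](tnth_nth _ _ (Ordinal lin)) tnth_mktuple /=.
rewrite !uphalf_half; case: (odd i) => /=; lia.
Qed.

(* Main.v *)
(* An alternating closed walk has a and b odd, so the parity of the vertex
   alternates with the parity of the step. Read from its endpoints of even
   step, the polygon that starts at v_k consists of the chords {y, y + a} and
   {y, y - b} with y of the parity of k. A symmetry of a polygon permutes its
   vertices, hence fixes their centroid 0; a reflection symmetry is therefore
   z |-> v_c z^*, that is y |-> c - y on the indices. If c is odd, this maps
   {y, y + d} to {y', y' + d} with y' = c - y - d of the same parity as y. If c is
   even, it keeps the parity of y and negates the steps, so that {a, -b} would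
   be stable under negation modulo n, which forces a = b = m. So there are
   exactly m axes, one for each odd c < n. *)
Require Import Defs.
From mathcomp Require Import zify ring lra.
Set Implicit Arguments.
Unset Strict Implicit.
Unset Printing Implicit Defensive.
Import Order.TTheory GRing.Theory Num.Theory.
Local Open Scope classical_set_scope.
Local Open Scope complex_scope.
Local Open Scope ring_scope.

(** * Segments, reflections and lines *)

Definition maps_segments (R : realType) (f : R[i] -> R[i]) :=
  forall p q, f @` segment p q = segment (f p) (f q).

Lemma segmentC (R : realType) (p q : R[i]) : segment p q = segment q p.
Proof.
suff sub (x y : R[i]) : segment x y `<=` segment y x.
  by apply/seteqP; split; apply: sub.
move=> _ [t /= /andP[t0 t1] <-]; exists (1 - t) => /=; first by lra.
by rewrite rmorphB rmorph1; ring.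
Qed.

Lemma segment_left (R : realType) (p q : R[i]) : segment p q p.
Proof. by exists 0 => /=; [lra | rewrite rmorph0 mul0r addr0]. Qed.

Lemma segment_right (R : realType) (p q : R[i]) : segment p q q.
Proof. by rewrite segmentC; exact: segment_left. Qed.

(** Each segment contains the endpoints of the other, so q - p and q' - p' are real multiples of
    each other, with factors in [-1, 1] whose product is 1. Each factor is then 1 or -1, which puts
    the parameters of the endpoints at 0 and 1. *)
Lemma segment_inj (R : realType) (p q p' q' : R[i]) : p != q ->
  segment p q = segment p' q' -> (p = p' /\ q = q') \/ (p = q' /\ q = p').
Proof.
move=> npq E.
have [t /= tP pE] : segment p' q' p by rewrite -E; exact: segment_left.
have [s /= sP qE] : segment p' q' q by rewrite -E; exact: segment_right.
have [t' /= t'P p'E] : segment p q p' by rewrite E; exact: segment_left.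
have [s' /= s'P q'E] : segment p q q' by rewrite E; exact: segment_right.
have D : q - p = (s - t)%:C * (q' - p').
  by rewrite -{1}qE -{1}pE rmorphB; ring.
have D' : q' - p' = (s' - t')%:C * (q - p).
  by rewrite -{1}q'E -{1}p'E rmorphB; ring.
have npq0 : q - p != 0 by rewrite subr_eq0 eq_sym.
have /complexI st1 : ((s - t) * (s' - t'))%:C = 1%:C.
  by apply: (mulIf npq0); rewrite rmorphM -mulrA -D' -D rmorph1 mul1r.
have [[t0 s1]|[t1 s0]] : t = 0 /\ s = 1 \/ t = 1 /\ s = 0.
- case: (lerP t s) => ts.
    by left; have : s - t = 1 by [nra]; lra.
  by right; have : s - t = -1 by [nra]; lra.
- by left; rewrite -pE -qE t0 s1 rmorph0 rmorph1; split; ring.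
- by right; rewrite -pE -qE t1 s0 rmorph0 rmorph1; split; ring.
Qed.

Lemma rotation_maps_segments (R : realType) (t : R) :
  maps_segments (rotation t).
Proof.
move=> p q; apply/seteqP; split=> [_ [_ [x xP <-] <-]|_ [x xP <-]].
  by exists x => //; rewrite /rotation; ring.
by exists (p + x%:C * (q - p)); [exists x | rewrite /rotation; ring].
Qed.

Lemma conj_real_complex (R : realType) (t : R) : (t%:C^*)%R = t%:C.
Proof. exact: conjc_real. Qed.

Lemma reflection_maps_segments (R : realType) (p u : R[i]) :
  maps_segments (reflection p u).
Proof.
have E x y t : reflection p u (x + t%:C * (y - x)) =
    reflection p u x + t%:C * (reflection p u y - reflection p u x).
  rewrite /reflection !(rmorphB, rmorphD, rmorphM) /= conj_real_complex; ring.
move=> x y; apply/seteqP; split=> [_ [_ [t tP <-] <-]|_ [t tP <-]].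
  by exists t; rewrite ?E.
by exists (x + t%:C * (y - x)); [exists t | rewrite E].
Qed.

Lemma reflectionK (R : realType) (p u : R[i]) : u != 0 ->
  involutive (reflection p u).
Proof.
move=> u0 z; have cu0 : (u^*)%R != 0 by rewrite conjC_eq0.
rewrite /reflection [p + _ - p]addrAC subrr add0r rmorphM /= fmorph_div /= !conjCK.
by field; rewrite u0 cu0.
Qed.

(** Lines can thus be compared through their reflections. A fixed point z makes (z - p) / u equal to
    its conjugate, hence real. *)
Lemma line_fixed (R : realType) (p u : R[i]) : u != 0 ->
  line p u = [set z | reflection p u z = z].
Proof.
move=> u0; have cu0 : (u^*)%R != 0 by rewrite conjC_eq0.
apply/seteqP; split=> [_ [t _ <-] /=|z /= zE].
  rewrite /reflection [p + _ - p]addrAC subrr add0r rmorphM /= conj_real_complex; field.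
  exact: cu0.
have : ((z - p) / u)%R \is Num.real.
  apply/CrealP; rewrite fmorph_div /=.
  rewrite -[in RHS]zE /reflection [p + _]addrC addrK; field.
  by rewrite u0 cu0.
case/complex_realP => t tE; exists t => //.
by rewrite -tE divfK ?addrNK // addrC subrK.
Qed.

Lemma line_eq_center (R : realType) (p u w : R[i]) : u != 0 -> w != 0 ->
  reflection p u =1 reflection 0 w -> line p u = line 0 w.
Proof.
move=> u0 w0 E; rewrite !line_fixed //.
by apply/seteqP; split=> z /=; rewrite E.
Qed.

(** * Vertices as powers of a primitive root of unity *)

Lemma cisD (R : realType) (x y : R) : cis (x + y) = cis x * cis y.
Proof.
rewrite /cis cosD sinD; apply/eqP; rewrite eq_complex /=.
by apply/andP; split; apply/eqP; ring.
Qed.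

Lemma cis0 (R : realType) : cis (0 : R) = 1.
Proof. by rewrite /cis cos0 sin0. Qed.

Lemma conj_cis (R : realType) (x : R) : ((cis x)^*)%R = cis (- x).
Proof. by rewrite /cis cosN sinN. Qed.

Lemma cis_neq0 (R : realType) (x : R) : cis x != 0.
Proof.
apply/eqP => x0; have := oner_neq0 R[i].
by rewrite -(cis0 R) -(subrr x) cisD x0 mul0r eqxx.
Qed.

Lemma cis_div_conj (R : realType) (x : R) : cis x / ((cis x)^*)%R = cis (x *+ 2).
Proof.
rewrite conj_cis mulr2n cisD; congr (_ * _).
apply: (mulIf (cis_neq0 (- x))); rewrite mulVf ?cis_neq0 //.
by rewrite -cisD subrr cis0.
Qed.

Lemma cisMn (R : realType) (x : R) k : cis (x *+ k) = cis x ^+ k.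
Proof.
by elim: k => [|k IHk]; rewrite ?mulr0n ?cis0 // mulrS cisD exprS IHk.
Qed.

Lemma vertexE (R : realType) n k : vertex R n k = vertex R n 1 ^+ k.
Proof.
rewrite /vertex -cisMn; congr cis; rewrite -mulr_natr; ring.
Qed.

Lemma vertex_prim (R : realType) n : (0 < n)%N ->
  n.-primitive_root (vertex R n 1).
Proof.
move=> n0; have n0R : (n%:R : R) != 0 by rewrite pnatr_eq0 -lt0n.
have zn : vertex R n 1 ^+ n = 1.
  rewrite -vertexE /vertex mulfK // mulr_natl /cis cos2pi mulr2n.
  by rewrite sinDpi sinpi oppr0.
have [d [dprim dn]] := prim_order_exists n0 zn.
suff nd : n = d by move: dprim; rewrite -nd; exact: id.
have d0 : (0 < d)%N := prim_order_gt0 dprim.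
apply/eqP; rewrite eqn_leq [(d <= n)%N]dvdn_leq // andbT leqNgt.
apply/negP => dltn.
have := prim_expr_order dprim; rewrite -vertexE /vertex => -[c1 _].
(* Half the angle of the vertex of index d: cos (2x) = 1 forces sin x = 0, whereas 0 < x < pi
   because d < n. *)
pose x : R := pi * d%:R / n%:R.
have : sin x ^+ 2 = 0.
  have : cos (x *+ 2) = 1 by rewrite -c1; congr cos; rewrite /x; ring.
  rewrite cos_mulr2n sin2cos2; lra.
move=> /eqP; rewrite expf_eq0 /= => /eqP s0.
have : 0 < sin x.
  apply: sin_gt0_pi; rewrite /x; have p0 := pi_gt0 R.
  rewrite divr_gt0 ?mulr_gt0 ?ltr0n //=.
  by rewrite ltr_pdivrMr ?ltr0n // ltr_pM2l // ltr_nat.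
by rewrite s0 ltxx.
Qed.

Lemma vertex_eq (R : realType) n i j : (0 < n)%N ->
  (vertex R n i == vertex R n j) = (i == j %[mod n]).
Proof.
by move=> n0; rewrite (vertexE R n i) (vertexE R n j) (eq_prim_root_expr (vertex_prim R n0)).
Qed.

Lemma vertexD (R : realType) n i j :
  vertex R n (i + j) = vertex R n i * vertex R n j.
Proof. by rewrite vertexE exprD -!vertexE. Qed.

Lemma vertex0 (R : realType) n : vertex R n 0 = 1.
Proof. by rewrite vertexE. Qed.

(** Indices are natural numbers, so [n.-1] stands for -1 modulo n. *)
Lemma conj_vertex (R : realType) n k : (0 < n)%N ->
  ((vertex R n k)^*)%R = vertex R n (n.-1 * k).
Proof.
move=> n0; have v0 : vertex R n k != 0 by exact: cis_neq0.
apply: (mulfI v0); rewrite -vertexD -mulSn prednK //.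
rewrite {1 2}/vertex conj_cis -cisD subrr cis0 -(vertex0 R n).
by apply/eqP; rewrite vertex_eq // mod0n modnMr.
Qed.

(** A geometric sum: multiplied by the nonzero v_1 - 1 it becomes v_n - 1 = 0. *)
Lemma sum_vertex (R : realType) n : (1 < n)%N ->
  \sum_(i < n) vertex R n i = 0.
Proof.
move=> n1; have n0 : (0 < n)%N by lia.
have z1 : vertex R n 1 - 1 != 0.
  rewrite subr_eq0 -(vertex0 R n) vertex_eq //.
  by rewrite mod0n modn_small.
apply: (mulfI z1); rewrite mulr0.
under eq_bigr do rewrite vertexE.
rewrite -subrX1 -vertexE -(vertex0 R n); apply/eqP.
by rewrite subr_eq0 vertex_eq // modnn mod0n.
Qed.

(** * Chords, and symmetries acting on the vertices *)

Definition chord (R : realType) n i j := segment (vertex R n i) (vertex R n j).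
Arguments chord : clear implicits.

Lemma eq_chord (R : realType) n i j i' j' : (0 < n)%N ->
  i = i' %[mod n] -> j = j' %[mod n] -> chord R n i j = chord R n i' j'.
Proof.
by move=> n0 /eqP Ei /eqP Ej; congr segment; apply/eqP; rewrite vertex_eq.
Qed.

Lemma chordC (R : realType) n i j : chord R n i j = chord R n j i.
Proof. exact: segmentC. Qed.

Lemma chord_inj (R : realType) n i j i' j' : (0 < n)%N ->
  i <> j %[mod n] -> chord R n i j = chord R n i' j' ->
  (i = i' %[mod n] /\ j = j' %[mod n]) \/ (i = j' %[mod n] /\ j = i' %[mod n]).
Proof.
move=> n0 /eqP; rewrite -(vertex_eq R) // => /segment_inj nij /nij.
by case=> -[/eqP + /eqP]; rewrite !vertex_eq // => /eqP ? /eqP ?; [left|right].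
Qed.

(* The sides of a polygon have their endpoints at the vertices, and segments
   determine their endpoints. *)
Lemma move_polygon_vertex (R : realType) n (f : R[i] -> R[i])
    (P : figure R) : (1 < n)%N -> maps_segments f -> injective f ->
  is_polygon n P -> is_polygon n (move f P) ->
  forall i : 'I_n, exists j : 'I_n, f (vertex R n i) = vertex R n j.
Proof.
move=> n1 fseg finj [s PE] [s' fPE] i.
have n0 : (0 < n)%N by lia.
pose i0 := (s^-1)%g i; have si0 : s i0 = i by rewrite /i0 permKV.
have : move f P (f @` chord R n (s i0) (s (ordS i0))).
  by exists (chord R n (s i0) (s (ordS i0))) => //; rewrite PE; exists i0.
rewrite fPE fseg => -[j _ /esym].
(* Consecutive vertices are distinct, so the image side is not reduced to a point and determines its
   endpoints. *)
have nf : f (vertex R n (s i0)) != f (vertex R n (s (ordS i0))).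
  rewrite (inj_eq finj) vertex_eq // !modn_small //.
  rewrite val_eqE (inj_eq perm_inj) -val_eqE /=.
  have := ltn_ord i0; rewrite leq_eqVlt => /orP[/eqP e|lt].
    by rewrite e modnn; lia.
  by rewrite modn_small //; lia.
case/(segment_inj nf); rewrite si0 => -[-> _]; first by exists (s' j).
by exists (s' (ordS j)).
Qed.

Lemma reflection_vertex (R : realType) n (p u : R[i]) (P : figure R) :
  (1 < n)%N -> u != 0 -> is_polygon n P -> move (reflection p u) P = P ->
  exists c : 'I_n, forall z, reflection p u z = vertex R n c * (z^*)%R.
Proof.
move=> n1 u0 Ppol Pfix; have n0 : (0 < n)%N by lia.
have finj : injective (reflection p u) by exact: inv_inj (reflectionK p u0).
have := move_polygon_vertex n1 (@reflection_maps_segments R p u) finj Ppol.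
rewrite Pfix => /(_ Ppol) /choice [g gE].
(* With w = u / u^* the reflection is z |-> w z^* + d. It permutes the vertices, whose sum is 0, so
   summing the images gives n d = 0; the image of v_0 = 1 then shows that w is a vertex. *)
pose d : R[i] := p - u / (u^*)%R * (p^*)%R.
have rE z : reflection p u z = u / (u^*)%R * (z^*)%R + d.
  by rewrite /reflection rmorphB /d; ring.
have ginj : injective g.
  move=> i j gij; apply/val_inj/eqP.
  rewrite -[val i](modn_small (ltn_ord i)) -[val j](modn_small (ltn_ord j)).
  by rewrite -(vertex_eq R) //; apply/eqP/finj; rewrite !gE gij.
have d0 : d = 0.
  have := sum_vertex R n1; rewrite (reindex_inj ginj) /=.
  under eq_bigr do rewrite -gE rE.
  rewrite big_split /= -mulr_sumr -rmorph_sum /= sum_vertex //.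
  rewrite rmorph0 mulr0 add0r.
  rewrite sumr_const card_ord => /eqP.
  by rewrite mulrn_eq0 eqn0Ngt n0 => /eqP.
exists (g (Ordinal n0)) => z; rewrite -gE /= vertex0 !rE d0 !addr0.
by rewrite rmorph1 mulr1.
Qed.

(** * Arithmetic of the alternating walk *)

Local Open Scope nat_scope.

Definition closes_up (n a b : nat) :=
  (forall i, 1 <= i <= n - 1 ->
     partial_sum (alternating n a b) i <> 0 %[mod n]) /\
  partial_sum (alternating n a b) n = 0 %[mod n].

Lemma eqmod_odd n x y : ~~ odd n -> x = y %[mod n] -> odd x = odd y.
Proof. by move=> /negbTE nE /(congr1 odd); rewrite !odd_mod. Qed.

Lemma position0 n (e : n.-tuple nat) k : position e k 0 = k.
Proof. by rewrite /position /partial_sum take0 addn0. Qed.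

(* If i is odd and j even, the sides between the i-th and the j-th position
   and those of an initial block of length n - (j - i) make up a full turn. *)
Lemma position_inj (n m a b k i j : nat) : n = 2 * m -> closes_up n a b ->
  i < n -> j < n ->
  position (alternating n a b) k i = position (alternating n a b) k j %[mod n] ->
  i = j.
Proof.
move=> nm [S0 Sn].
wlog ltij : i j / i < j => [W|] iltn jltn.
  by case: (ltngtP i j) => // lt E; [exact: W | apply/esym; exact: W].
move/eqP; rewrite eqn_modDl => /eqP E; exfalso.
have SE := @partial_sum_alternating n a b.
move: E Sn; rewrite !SE ?(ltnW iltn) ?(ltnW jltn) // => E Sn.
case: (boolP (odd i && ~~ odd j)) => [/andP[oi oj]|ij].
- apply: (S0 (n - (j - i))); first by clear -ltij jltn; lia.
  rewrite SE ?leq_subr //.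
  apply/eqP; rewrite -(eqn_modDr (uphalf j * a + j./2 * b)).
  have -> : uphalf (n - (j - i)) * a + (n - (j - i))./2 * b +
            (uphalf j * a + j./2 * b) =
            uphalf i * a + i./2 * b + (uphalf n * a + n./2 * b).
    have uE : uphalf (n - (j - i)) + uphalf j = uphalf i + uphalf n.
      by clear -nm ltij jltn oi oj; lia.
    have hE : (n - (j - i))./2 + j./2 = i./2 + n./2.
      by clear -nm ltij jltn oi oj; lia.
    by rewrite addnACA -!mulnDl uE hE !mulnDl addnACA.
  by rewrite add0n -E -modnDmr Sn modnDmr addn0.
(* In the other parity cases the sides from step i to step j contain as many a's and b's as the
   first j - i sides. *)
- apply: (S0 (j - i)); first by clear -ltij jltn; lia.
  rewrite SE; last by clear -ltij jltn; lia.
  apply/eqP; rewrite -(eqn_modDr (uphalf i * a + i./2 * b)) add0n E.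
  apply/eqP; congr (_ %% _).
  have -> : uphalf j = uphalf (j - i) + uphalf i by clear -ij ltij; lia.
  have -> : j./2 = (j - i)./2 + i./2 by clear -ij ltij; lia.
  by rewrite !mulnDl addnACA.
Qed.

(** The positions modulo n form an injective map from ['I_n] to itself, which is therefore onto. *)
Lemma position_surj (n m a b k y : nat) : n = 2 * m -> 0 < n ->
  closes_up n a b ->
  exists i : 'I_n, position (alternating n a b) k i = y %[mod n].
Proof.
move=> nm n0 cl.
pose g (i : 'I_n) := Ordinal (ltn_pmod (position (alternating n a b) k i) n0).
have ginj : injective g.
  by move=> i j [] /(position_inj nm cl (ltn_ord i) (ltn_ord j)) /val_inj.
have [h _ hK] := injF_bij ginj.
exists (h (Ordinal (ltn_pmod y n0))).
by have := congr1 val (hK (Ordinal (ltn_pmod y n0))).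
Qed.

(** Here s_n = m (a + b), so divisibility by 2m makes a + b even. If a and b were both even, a walk
    from 0 would meet only even residues, since n is even, and would miss 1. *)
Lemma closes_up_odd (n m a b : nat) : n = 2 * m -> 0 < n ->
  closes_up n a b -> odd a /\ odd b.
Proof.
move=> nm n0 cl; have nE : ~~ odd n by lia.
have ab : odd a = odd b.
  have [_] := cl; rewrite partial_sum_alternating // mod0n => /eqP.
  have -> : uphalf n * a + n./2 * b = m * (a + b).
    have -> : uphalf n = m by lia.
    have -> : n./2 = m by lia.
    ring.
  rewrite -/(dvdn n _) nm [2 * m]mulnC dvdn_pmul2l; last by clear -nm n0; lia.
  by clear; lia.
suff oa : odd a by rewrite -ab.
have [i iE] := position_surj 0 1 nm n0 cl.
have := eqmod_odd nE iE.
rewrite /position partial_sum_alternating ?(ltnW (ltn_ord i)) //.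
by rewrite add0n oddD !oddM -ab; case: (odd a) => //; rewrite !andbF.
Qed.

Lemma odd_position (n a b k i : nat) : odd a -> odd b -> i <= n ->
  odd (position (alternating n a b) k i) = odd k (+) odd i.
Proof.
move=> oa ob ilen; rewrite /position partial_sum_alternating //.
by rewrite !oddD !oddM oa ob !andbT; congr addb; lia.
Qed.

Lemma position_step (n a b k i : nat) : i < n ->
  position (alternating n a b) k i.+1 =
  position (alternating n a b) k i + (if odd i then b else a).
Proof.
move=> iltn; rewrite /position !partial_sum_alternating //; last by lia.
case: (boolP (odd i)) => oi.
  have -> : uphalf i.+1 = uphalf i by lia.
  have -> : i.+1./2 = i./2 + 1 by lia.
  ring.
have -> : uphalf i.+1 = uphalf i + 1 by lia.
have -> : i.+1./2 = i./2 by lia.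
ring.
Qed.

(** * The figure traced by the alternating walk *)

Definition alternating_figure (R : realType) (n a b k : nat) : figure R :=
  [set segment (vertex R n (position (alternating n a b) k i))
               (vertex R n (position (alternating n a b) k i.+1))
  | i in [set: 'I_n]].
Arguments alternating_figure : clear implicits.

Lemma position_closed (n a b k : nat) : closes_up n a b ->
  position (alternating n a b) k n = k %[mod n].
Proof. by case=> _ Sn; rewrite /position -modnDmr Sn modnDmr addn0. Qed.

Lemma alternating_figure_polygon (R : realType) (n m a b k : nat) :
  n = 2 * m -> 0 < n -> closes_up n a b ->
  is_polygon n (alternating_figure R n a b k).
Proof.
move=> nm n0 cl.
pose g (i : 'I_n) := Ordinal (ltn_pmod (position (alternating n a b) k i) n0).
have ginj : injective g.
  by move=> i j [] /(position_inj nm cl (ltn_ord i) (ltn_ord j)) /val_inj.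
exists (perm ginj); apply: eq_imagel => i _; rewrite !permE /=.
apply: eq_chord => //; first by rewrite modn_mod.
rewrite modn_mod; have := ltn_ord i; rewrite leq_eqVlt => /orP[/eqP e|lt].
  by rewrite e modnn position_closed // position0.
by rewrite [i.+1 %% n]modn_small.
Qed.

Lemma alternating_figure_represented (R : realType) (n m a b : nat) (k : 'I_n) :
  n = 2 * m -> 0 < n -> 0 < a < n -> 0 < b < n -> closes_up n a b ->
  represents (alternating n a b) (alternating_figure R n a b k).
Proof.
move=> nm n0 an bn cl; split.
  move=> x /= /mapP[i _ ->]; case: ifP => _; lia.
exists k; split => //; last exact: position_closed.
move=> j; have [i iE] := position_surj k j nm n0 cl.
exists i; split=> // i' i'E; apply/val_inj.
by apply: (position_inj (k := k) nm cl (ltn_ord i) (ltn_ord i')); rewrite iE i'E.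
Qed.

Lemma move_rotation_alternating (R : realType) (n a b k r : nat) (t : R) :
  cis t = vertex R n r ->
  move (rotation t) (alternating_figure R n a b k) =
  alternating_figure R n a b (r + k).
Proof.
move=> tr.
have E i : rotation t @` segment (vertex R n (position (alternating n a b) k i))
      (vertex R n (position (alternating n a b) k i.+1)) =
    segment (vertex R n (position (alternating n a b) (r + k) i))
      (vertex R n (position (alternating n a b) (r + k) i.+1)).
  by rewrite rotation_maps_segments /rotation tr -!vertexD /position !addnA.
apply/seteqP; split=> [_ [_ [i _ <-] <-]|_ [i _ <-]]; first by exists i.
by rewrite -E; eexists; [exists i|].
Qed.

(* A side of length b is read backwards, from its endpoint of even step, where
   it becomes a move by n - b. *)
Lemma alternating_figureE (R : realType) (n m a b k : nat) :
  n = 2 * m -> 0 < n -> b <= n -> closes_up n a b ->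
  alternating_figure R n a b k =
  [set S | exists y d, [/\ odd y = odd k, d = a \/ d = n - b
                         & S = chord R n y (y + d)]].
Proof.
move=> nm n0 bn cl; have [oa ob] := closes_up_odd nm n0 cl.
have nE : ~~ odd n by lia.
apply/seteqP; split => [_ [i _ <-]|S [y [d [yk dE ->]]]] /=.
  have pE := odd_position k oa ob (ltnW (ltn_ord i)).
  have pE' := odd_position k oa ob (ltn_ord i).
  have sE := position_step a b k (ltn_ord i).
  case: (boolP (odd i)) sE => oi sE.
    exists (position (alternating n a b) k i.+1), (n - b); split.
    - by rewrite pE' /= oi addbF.
    - by right.
    rewrite -/(chord _ _ _ _) chordC; apply: eq_chord => //.
    by rewrite sE -addnA subnKC // modnDr.
  exists (position (alternating n a b) k i), a; split.
  - by rewrite pE (negbTE oi) addbF.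
  - by left.
  by rewrite -/(chord _ _ _ _) -sE.
(* The vertex y is visited at some step i, which is even by parity: a side of length a leaves it and
   a side of length b arrives at it. *)
have [i iE] := position_surj k y nm n0 cl.
have oi : ~~ odd i.
  have := eqmod_odd nE iE; rewrite odd_position ?(ltnW (ltn_ord i)) // yk.
  by case: (odd k) (odd i) => [] [].
case: dE => ->.
  exists i => //; apply: eq_chord => //.
  by rewrite position_step // (negbTE oi) -modnDml iE modnDml.
(* The side arriving at step i has index i - 1, or n - 1 when i = 0. *)
have [j jodd jE] : exists2 j : 'I_n, odd j &
    position (alternating n a b) k j.+1 = y %[mod n].
  case: i oi iE => -[|i] ltin /= oi iE.
    have n1 : n.-1 < n by lia.
    exists (Ordinal n1) => /=; first by lia.
    by rewrite prednK // position_closed // -iE position0.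
  by exists (Ordinal (ltnW ltin)) => //=; rewrite negbK in oi.
exists j => //; rewrite -/(chord _ _ _ _) chordC; apply: eq_chord => //.
apply/eqP; rewrite -(eqn_modDr b) -addnA subnK // modnDr -jE.
by rewrite position_step // jodd.
Qed.

(** * The axes of the alternating polygon *)

Definition axis_direction (R : realType) (n c : nat) : R[i] :=
  cis (pi * c%:R / n%:R)%R.
Arguments axis_direction : clear implicits.

(** The direction u has half the angle of v_c, so u / u^* = v_c. *)
Lemma reflection_axis_direction (R : realType) n c (z : R[i]) :
  reflection 0%R (axis_direction R n c) z = (vertex R n c * (z^*))%R.
Proof.
rewrite /reflection add0r subr0 cis_div_conj /vertex; congr (cis _ * _)%R.
ring.
Qed.

(** If the lines agree, the direction w of one is fixed by both reflections, so v_c w^* = v_c' w^*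
    and w^* cancels. *)
Lemma line_axis_direction_inj (R : realType) n : 0 < n ->
  {in [pred c | c < n] &, injective (fun c => line 0%R (axis_direction R n c))}.
Proof.
move=> n0 c c'; rewrite !inE => cn c'n E.
have dn0 j : axis_direction R n j != 0%R by exact: cis_neq0.
have : line 0%R (axis_direction R n c') (axis_direction R n c).
  by rewrite -E; exists 1%R => //; rewrite rmorph1; ring.
rewrite line_fixed //= reflection_axis_direction => H.
have : line 0%R (axis_direction R n c) (axis_direction R n c).
  by exists 1%R => //; rewrite rmorph1; ring.
rewrite line_fixed //= reflection_axis_direction -[X in _ = X]H.
move/mulIf; rewrite conjC_eq0 => /(_ (dn0 c)) /eqP.
by rewrite vertex_eq // !modn_small // => /eqP.
Qed.

Lemma reflection_chord (R : realType) n c (p u : R[i]) i j : 0 < n ->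
  (forall z, reflection p u z = vertex R n c * (z^*))%R ->
  reflection p u @` chord R n i j =
  chord R n (c + n.-1 * i) (c + n.-1 * j).
Proof.
move=> n0 fE; rewrite reflection_maps_segments !fE !conj_vertex //.
by rewrite -!vertexD.
Qed.

Lemma reflection_alternating (R : realType) (n m a b k c : nat) (p u : R[i]) :
  n = 2 * m -> 0 < n -> b <= n -> closes_up n a b -> u != 0%R ->
  (forall z, reflection p u z = vertex R n c * (z^*))%R -> odd c ->
  move (reflection p u) (alternating_figure R n a b k) =
  alternating_figure R n a b k.
Proof.
move=> nm n0 bn cl u0 fE oc; have [oa ob] := closes_up_odd nm n0 cl.
have on : odd n.-1 by clear -nm n0; lia.
set P := alternating_figure R n a b k.
have sub : move (reflection p u) P `<=` P.
  rewrite /P (alternating_figureE R k nm n0 bn cl).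
  move=> _ [_ [y [d [yk dE ->]] <-]]; rewrite (reflection_chord _ _ n0 fE).
  (* The endpoints exchange roles: the new base point is c - (y + d), of the parity of k because c
     and d are odd. *)
  exists (c + n.-1 * (y + d)), d.
  have od : odd d by case: dE => -> //; clear -nm bn ob; lia.
  split => //; first by rewrite oddD oddM oddD oc on od yk; case: (odd k).
  rewrite chordC; apply: eq_chord => //.
  have -> : c + n.-1 * (y + d) + d = d * n.-1.+1 + (c + n.-1 * y) by ring.
  by rewrite prednK // modnMDl.
(* The reflection is an involution, so the inclusion [sub] yields the reverse one. *)
apply/seteqP; split=> // S PS.
have E : reflection p u @` (reflection p u @` S) = S.
  rewrite image_comp; have -> : reflection p u \o reflection p u = id.
    by apply/funext => z /=; rewrite reflectionK.
  exact: image_id.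
by exists (reflection p u @` S) => //; apply: sub; exists S.
Qed.

Lemma dvdn_lt_double n x : n %| x -> 0 < x < 2 * n -> x = n.
Proof. by move=> /dvdnP[q ->]; case: q => [|[|q]]; lia. Qed.

Lemma reflection_alternating_odd (R : realType) (n m a b k c : nat)
    (p u : R[i]) :
  n = 2 * m -> 0 < a -> a < b -> b < n -> closes_up n a b ->
  (forall z, reflection p u z = vertex R n c * (z^*))%R ->
  move (reflection p u) (alternating_figure R n a b k) =
    alternating_figure R n a b k ->
  odd c.
Proof.
move=> nm a0 ab bn cl fE; have n0 : 0 < n by clear -bn; lia.
have [oa ob] := closes_up_odd nm n0 cl.
have nE : ~~ odd n by clear -nm; lia.
have on : odd n.-1 by clear -nm n0; lia.
rewrite (alternating_figureE R k nm n0 (ltnW bn) cl) => Pfix.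
case: (boolP (odd c)) => // oc.
(* For c even, the image of the chord {k, k + d} has its endpoint c - k of the parity of k, and from
   there it is a step by -d. Hence -d is congruent to an allowed step d'. *)
have step d : d = a \/ d = n - b ->
    exists2 d', d' = a \/ d' = n - b & n %| d + d'.
  move=> dE.
  have od : odd d by case: dE => -> //; clear -nm bn ob; lia.
  have : move (reflection p u)
      [set S | exists y d, [/\ odd y = odd k, d = a \/ d = n - b
                             & S = chord R n y (y + d)]]
      (reflection p u @` chord R n k (k + d)).
    by exists (chord R n k (k + d)) => //; exists k, d.
  rewrite Pfix (reflection_chord _ _ n0 fE) => -[y [d' [yk d'E]]].
  have od' : odd d' by case: d'E => -> //; clear -nm bn ob; lia.
  have nc : c + n.-1 * k <> c + n.-1 * (k + d) %[mod n].
    move=> /(eqmod_odd nE); rewrite !(oddD, oddM) on od /=.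
    by case: (odd c) (odd k) => [] [].
  (* Matching c - k with y + d' is impossible by parity, since d' is odd. *)
  case/(chord_inj n0 nc) => -[e1 e2]; last first.
    have := eqmod_odd nE e1; rewrite !(oddD, oddM) on od' yk (negbTE oc) /=.
    by case: (odd k).
  exists d' => //; rewrite /dvdn -(mod0n n) -(eqn_modDl y) addn0.
  have -> : y + (d + d') = y + d' + d by ring.
  rewrite -modnDml -e2 modnDml.
  have -> : c + n.-1 * (k + d) + d = d * n.-1.+1 + (c + n.-1 * k) by ring.
  by rewrite prednK // modnMDl e1.
(* As 0 < a + (n - b) < n, the partner of a must be a and that of n - b must be n - b. So 2a = n =
   2(n - b), which contradicts a < b. *)
have [d1 d1E D1] := step a (or_introl erefl).
have [d2 d2E D2] := step (n - b) (or_intror erefl).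
have aE : a + a = n.
  case: d1E D1 => -> D1; first by apply: dvdn_lt_double => //; clear -a0 ab bn; lia.
  by have := dvdn_lt_double D1; clear -a0 ab bn; lia.
have bE : n - b + (n - b) = n.
  case: d2E D2 => -> D2; last by apply: dvdn_lt_double => //; clear -a0 ab bn; lia.
  by have := dvdn_lt_double D2; clear -a0 ab bn; lia.
clear -aE bE ab bn; lia.
Qed.

Lemma alternating_figure_axes (R : realType) (n m a b k : nat) :
  n = 2 * m -> 0 < a -> a < b -> b < n -> closes_up n a b ->
  has_axes m (alternating_figure R n a b k).
Proof.
move=> nm a0 ab bn cl; have n0 : 0 < n by clear -bn; lia.
have n1 : 1 < n by clear -nm n0; lia.
(* The odd c < n = 2m are the numbers 2j + 1 with j < m, which gives the count m. *)
pose L j := line 0%R (axis_direction R n (2 * j + 1)).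
have Linj : {in `I_m &, injective L}.
  move=> j j'; rewrite !inE /= => jm j'm /line_axis_direction_inj.
  by rewrite !inE => /(_ n0); clear -jm j'm nm; lia.
have dn0 j : axis_direction R n j != 0%R by exact: cis_neq0.
rewrite /has_axes.
suff -> : [set l | is_axis (alternating_figure R n a b k) l] = L @` `I_m.
  exact: inj_card_eq.
apply/seteqP; split=> [_ /= [p [u [u0 -> Pfix]]]|_ [j _ <-]].
  have Ppol := alternating_figure_polygon R k nm n0 cl.
  have [c fE] := reflection_vertex n1 u0 Ppol Pfix.
  have oc := reflection_alternating_odd nm a0 ab bn cl fE Pfix.
  have cn := ltn_ord c.
  exists c./2; first by rewrite /=; clear -cn oc nm; lia.
  rewrite /L; have -> : 2 * c./2 + 1 = c by clear -oc; lia.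
  by apply/esym/line_eq_center => // z; rewrite reflection_axis_direction fE.
exists 0%R, (axis_direction R n (2 * j + 1)); split => //.
apply: (@reflection_alternating _ _ m _ _ _ (2 * j + 1)) => //.
- exact: ltnW.
- by move=> z; rewrite reflection_axis_direction.
- by clear; lia.
Qed.

(* Representation of a class and the congruence conditions *)
Local Close Scope ring_scope.
Local Close Scope complex_scope.

Theorem theorem2 (R : realType) (n m : nat) (hnm : n = (2 * m)%N)
    (hn : (3 < n)%N) (a b : nat) (ha : (1 <= a)%N) (hab : (a < b)%N)
    (hb : (b <= n - 1)%N) :
  (exists C : set (figure R),
      [/\ polygon_class n C,
          forall P, C P -> has_axes m P
        & class_represented C (alternating n a b)])
  <->
  ((forall i : nat, (1 <= i <= n - 1)%N ->
      partial_sum (alternating n a b) i <> 0%N %[mod n]) /\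
   partial_sum (alternating n a b) n = 0%N %[mod n]).
Proof.
have n0 : 0 < n by clear -hn; lia.
have n1 : 1 < n by clear -hn; lia.
split=> [[C [[P [Ppol CE]] _ Crep]]|cl].
  (* The class contains P itself, through the rotation by angle 0. *)
  have [_ [k [surj kn _]]] : represents (alternating n a b) P.
    apply: Crep; rewrite CE; split => //; exists 0%R.
    have -> : rotation (0%R : R) = id.
      by apply/funext => z; rewrite /rotation cis0 mul1r.
    apply/seteqP; split=> [S PS|_ [S PS <-]]; last by rewrite image_id.
    by exists S => //; rewrite image_id.
  have closed i : position (alternating n a b) k i = k %[mod n] ->
      partial_sum (alternating n a b) i = 0 %[mod n].
    by move/eqP; rewrite /position -[X in _ == X %[mod n]]addn0 eqn_modDl => /eqP.
  split; last exact: closed.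
  move=> i /andP[i0 iln] Si.
  have iltn : i < n by clear -iln n0; lia.
  (* If s_i vanished modulo n, the start k would be visited at step i as well as at step 0, against
     uniqueness. *)
  have [x [_ xU]] := surj k.
  have xi : x = Ordinal iltn.
    by apply: xU; rewrite /position /= -modnDmr Si modnDmr addn0.
  have x0 : x = Ordinal n0 by apply: xU; rewrite /= position0.
  by have := congr1 val xi; rewrite x0 /= => i00; rewrite -i00 in i0.
have bn : b < n by clear -hb n0; lia.
have Ppol := alternating_figure_polygon R 0 hnm n0 cl.
(* A rotation between two polygons sends v_0 = 1 to some v_r, hence is the rotation by r steps.
   Every member of the class is therefore the same walk started at v_r. *)
have figE Q : is_polygon n Q -> rot_equiv (alternating_figure R n a b 0) Q ->
    exists r : 'I_n, Q = alternating_figure R n a b r.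
  move=> + [t QE]; rewrite QE => Qpol.
  have rinj : injective (rotation t) by exact: mulfI (cis_neq0 t).
  have [r] := move_polygon_vertex n1 (@rotation_maps_segments R t) rinj
    Ppol Qpol (Ordinal n0).
  rewrite /rotation vertex0 mulr1 => tr; exists r.
  by rewrite (move_rotation_alternating _ _ _ tr) addn0.
exists [set Q | is_polygon n Q /\ rot_equiv (alternating_figure R n a b 0) Q].
split.
- by exists (alternating_figure R n a b 0).
- by move=> Q [/figE H /H [r ->]]; exact: alternating_figure_axes.
move=> Q [/figE H /H [r ->]].
by apply: (alternating_figure_represented R _ hnm) => //; clear -ha hab bn; lia.
Qed.
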